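(* For any integers $n\ge k>1$, $$\mathfrak{S}_n(\mathrm{A}_k)=\mathfrak{S}_n(\widetilde{\mathrm{A}}_k)\qquad\text{and}\qquad \mathfrak{S}_n(\mathrm{D}_k)=\mathfrak{S}_n(\widetilde{\mathrm{D}}_k).$$
   Context: $\mathfrak{S}_n$ is the set of permutations $\sigma=\sigma_1\sigma_2\cdots\sigma_n$ of $[n]=\{1,\dots,n\}$ in one-line notation. A mesh pattern is a pair $p=(\pi,R)$ with $\pi\in\mathfrak{S}_m$ and $R\subseteq\{0,\dots,m\}\times\{0,\dots,m\}$ (the set of shaded unit cells, each given by its bottom-left corner, in the grid with dots at $(i,\pi_i)$). An occurrence of $p$ in $\sigma\in\mathfrak{S}_n$ is a choice of indices $i_1<\cdots<i_m$ such that $\sigma_{i_1}\cdots\sigma_{i_m}$ is order-isomorphic to $\pi$ and, for every $(a,b)\in R$, there is no index $r$ with $i_a<r<i_{a+1}$ and $v_b<\sigma_r<v_{b+1}$; here $v_1<\cdots<v_m$ is the increasing rearrangement of $\sigma_{i_1},\dots,\sigma_{i_m}$, $i_0=v_0=0$ and $i_{m+1}=v_{m+1}=n+1$. $\mathfrak{S}_n(p)$ is the set of permutations in $\mathfrak{S}_n$ with no occurrence of $p$. The mesh patterns: $\mathrm{A}_k=(12\cdots k,\{(0,k),(k,0)\})$, $\mathrm{D}_k=(k(k-1)\cdots 1,\{(0,0),(k,k)\})$, and $\widetilde{\mathrm{A}}_k=(12\cdots k,R)$, $\widetilde{\mathrm{D}}_k=(k(k-1)\cdots1,R)$ with all four corners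 shaded, $R=\{(0,0),(0,k),(k,0),(k,k)\}$. *)

(* Defs.v *)
From mathcomp Require Import all_boot all_fingroup.

Set Implicit Arguments.
Unset Strict Implicit.
Unset Printing Implicit Defensive.

(* An element sigma of 'S_n permutes 'I_n = {0, ..., n-1};
   the letter sigma_r of its one-line notation, 1 <= r <= n, is
   (sigma (r - 1)).+1. *)

(* The cells are indexed by {0, ..., m} x {0, ..., m} without any shift. *)
Record mesh_pattern (m : nat) := MeshPattern {
  mesh_perm : 'S_m;
  mesh_shading : {set 'I_m.+1 * 'I_m.+1}
}.

(* i_0 = 0, i_1, ..., i_m, i_(m+1) = n + 1, with i_(a+1) = (f a).+1. *)
Definition positions (m n : nat) (f : {ffun 'I_m -> 'I_n}) : seq nat :=
  0 :: rcons [seq (f a).+1 | a <- enum 'I_m] n.+1.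

(* v_0 = 0, v_1 <= ... <= v_m, v_(m+1) = n + 1. *)
Definition values (m n : nat) (sigma : 'S_n) (f : {ffun 'I_m -> 'I_n}) :
    seq nat :=
  0 :: rcons (sort leq [seq (sigma (f a)).+1 | a <- enum 'I_m]) n.+1.

(* The point (r + 1, sigma_(r + 1)) lies in the open cell with bottom-left
   corner c. *)
Definition in_cell (m n : nat) (sigma : 'S_n) (f : {ffun 'I_m -> 'I_n})
    (c : 'I_m.+1 * 'I_m.+1) (r : 'I_n) : bool :=
  (nth 0 (positions f) c.1 < r.+1 < nth 0 (positions f) c.1.+1) &&
  (nth 0 (values sigma f) c.2 < (sigma r).+1 < nth 0 (values sigma f) c.2.+1).

Definition occurrence (m n : nat) (sigma : 'S_n) (f : {ffun 'I_m -> 'I_n})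
    (p : mesh_pattern m) : bool :=
  [&& [forall a : 'I_m, forall b : 'I_m, (a < b) ==> (f a < f b)],
      [forall a : 'I_m, forall b : 'I_m,
        (sigma (f a) < sigma (f b)) == (mesh_perm p a < mesh_perm p b)] &
      [forall c in mesh_shading p, forall r : 'I_n, ~~ in_cell sigma f c r]].

Definition avoiders (n m : nat) (p : mesh_pattern m) : {set 'S_n} :=
  [set sigma : 'S_n | ~~ [exists f : {ffun 'I_m -> 'I_n}, occurrence sigma f p]].

Definition increasing_perm (k : nat) : 'S_k := 1%g.

Definition decreasing_perm (k : nat) : 'S_k := perm (@rev_ord_inj k).

Definition corners (k : nat) : {set 'I_k.+1 * 'I_k.+1} :=
  [set (ord0, ord0); (ord0, ord_max); (ord_max, ord0); (ord_max, ord_max)].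

Definition meshA (k : nat) : mesh_pattern k :=
  MeshPattern (increasing_perm k) [set (ord0, ord_max); (ord_max, ord0)].

Definition meshD (k : nat) : mesh_pattern k :=
  MeshPattern (decreasing_perm k) [set (ord0, ord0); (ord_max, ord_max)].

Definition meshA_tilde (k : nat) : mesh_pattern k :=
  MeshPattern (increasing_perm k) (corners k).

Definition meshD_tilde (k : nat) : mesh_pattern k :=
  MeshPattern (decreasing_perm k) (corners k).

(* Main.v *)
Require Import Defs.
From mathcomp Require Import all_boot all_fingroup.

Set Implicit Arguments.
Unset Strict Implicit.
Unset Printing Implicit Defensive.

(** Two extra shaded cells can only destroy occurrences, so everything rests on
    turning an occurrence of [meshA k] into one of [meshA_tilde k], and likewise
    for D.  Take an occurrence i_1 < ... < i_k of the pattern with two shaded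
    corners whose width i_k - i_1 is as large as possible.  If a point (r, s_r)
    lay in one of the other two corners, say left of i_1 on the side that
    prolongs the monotone sequence, then r could replace i_1: the sequence stays
    monotone, and both shaded corners are replaced by subsets of themselves,
    because i_1 only bounds one side of each.  Here k > 1 matters: i_k is not
    changed.  The new occurrence is wider, a contradiction.

    The argument never uses more about the values than a transitive relation
    [R] along the sequence ([widest_chain_unshaded]); A is the case where [R]
    says that values increase, D the case where it says that they decrease.
    The other lemmas translate the cells of the corners, which are defined
    through sorted lists, to this language. *)

(** * Widest monotone sequences *)

(** The length m + 2 makes the first and the last entry distinct, which the
    replacement of one of them relies on. *)
Definition chain n m (R : rel 'I_n) (f : {ffun 'I_m.+2 -> 'I_n}) : bool :=
  [forall a : 'I_m.+2, forall b : 'I_m.+2,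
     (a < b) ==> (f a < f b) && R (f a) (f b)].

(** The corners shaded already in [meshA] and [meshD]: upper left and lower
    right when [R] compares values upwards, lower left and upper right when it
    compares them downwards. *)
Definition across_empty n m (R : rel 'I_n) (f : {ffun 'I_m.+2 -> 'I_n}) :
    bool :=
  [forall r : 'I_n, ~~ ((r < f ord0) && R (f ord_max) r)
                 && ~~ ((f ord_max < r) && R r (f ord0))].

(** The corners added in [meshA_tilde] and [meshD_tilde]: a point there
    prolongs the sequence. *)
Definition along_empty n m (R : rel 'I_n) (f : {ffun 'I_m.+2 -> 'I_n}) :
    bool :=
  [forall r : 'I_n, ~~ ((r < f ord0) && R r (f ord0))
                 && ~~ ((f ord_max < r) && R (f ord_max) r)].

Lemma chainP n m (R : rel 'I_n) (f : {ffun 'I_m.+2 -> 'I_n}) :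
  reflect (forall a b : 'I_m.+2, a < b -> f a < f b /\ R (f a) (f b))
          (chain R f).
Proof.
apply: (iffP forallP) => [H a b lt_ab|H a].
  by move: (H a) => /forallP/(_ b)/implyP/(_ lt_ab)/andP.
by apply/forallP=> b; apply/implyP=> /H [-> ->].
Qed.

Definition set_first n m (f : {ffun 'I_m.+2 -> 'I_n}) (r : 'I_n) :
    {ffun 'I_m.+2 -> 'I_n} :=
  [ffun a => if a == ord0 then r else f a].

Definition set_last n m (f : {ffun 'I_m.+2 -> 'I_n}) (r : 'I_n) :
    {ffun 'I_m.+2 -> 'I_n} :=
  [ffun a => if a == ord_max then r else f a].

Lemma set_first_chain n m (R : rel 'I_n) (f : {ffun 'I_m.+2 -> 'I_n})
    (r : 'I_n) :
    transitive R -> chain R f -> r < f ord0 -> R r (f ord0) ->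
  chain R (set_first f r).
Proof.
move=> trR /chainP chf lt_r Rr; apply/chainP=> a b lt_ab; rewrite !ffunE.
have -> : (b == ord0) = false by apply/negP=> /eqP b0; rewrite b0 in lt_ab.
case: eqP => [a0|_]; last exact: chf.
have [|lt0 R0] := chf ord0 b; first by rewrite a0 in lt_ab.
by split; [apply: ltn_trans lt0 | apply: trR R0].
Qed.

Lemma set_last_chain n m (R : rel 'I_n) (f : {ffun 'I_m.+2 -> 'I_n})
    (r : 'I_n) :
    transitive R -> chain R f -> f ord_max < r -> R (f ord_max) r ->
  chain R (set_last f r).
Proof.
move=> trR /chainP chf lt_r Rr; apply/chainP=> a b lt_ab; rewrite !ffunE.
have -> : (a == ord_max) = false.
  by apply/negP=> /eqP a_max; move: lt_ab; rewrite a_max ltnNge -ltnS ltn_ord.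
case: eqP => [b_max|_]; last exact: chf.
have [|lt_max R_max] := chf a ord_max; first by rewrite b_max in lt_ab.
by split; [apply: ltn_trans lt_r | apply: trR Rr].
Qed.

Lemma set_first_across_empty n m (R : rel 'I_n) (f : {ffun 'I_m.+2 -> 'I_n})
    (r : 'I_n) :
    transitive R -> across_empty R f -> r < f ord0 -> R r (f ord0) ->
  across_empty R (set_first f r).
Proof.
move=> trR /forallP emp lt_r Rr; apply/forallP=> x; rewrite !ffunE ?eqxx /=.
have /andP[empl empr] := emp x; apply/andP; split.
  by apply: contra empl => /andP[lt_x ->]; rewrite (ltn_trans lt_x).
by apply: contra empr => /andP[-> Rx]; apply: trR Rr.
Qed.

Lemma set_last_across_empty n m (R : rel 'I_n) (f : {ffun 'I_m.+2 -> 'I_n})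
    (r : 'I_n) :
    transitive R -> across_empty R f -> f ord_max < r -> R (f ord_max) r ->
  across_empty R (set_last f r).
Proof.
move=> trR /forallP emp lt_r Rr; apply/forallP=> x; rewrite !ffunE ?eqxx /=.
have /andP[empl empr] := emp x; apply/andP; split.
  by apply: contra empl => /andP[-> Rx]; apply: trR Rx.
by apply: contra empr => /andP[lt_x ->]; rewrite (ltn_trans lt_r).
Qed.

(** Replacing an end of the sequence by a point that prolongs it shrinks both
    corners of [across_empty] and widens the sequence, so a widest sequence
    admits no such point. *)
Lemma widest_chain_unshaded n m (R : rel 'I_n) (f : {ffun 'I_m.+2 -> 'I_n}) :
    transitive R -> chain R f -> across_empty R f ->
  exists g : {ffun 'I_m.+2 -> 'I_n},
    [&& chain R g, across_empty R g & along_empty R g].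
Proof.
move=> trR chf empf.
pose P := [pred g : {ffun 'I_m.+2 -> 'I_n} | chain R g && across_empty R g].
have Pf : P f by rewrite /= chf.
case: (@arg_maxnP _ f P (fun g => g ord_max - g ord0) Pf).
move=> g /andP[chg empg] gmax.
exists g; rewrite chg empg; apply/forallP=> r.
have [lt_g _] : g ord0 < g ord_max /\ _ := chainP _ _ chg ord0 ord_max isT.
apply/andP; split; apply/negP=> /andP[lt_r Rr].
- have := gmax (set_first g r); rewrite !ffunE ?eqxx /=.
  rewrite set_first_chain ?set_first_across_empty // => /(_ isT).
  by apply/negP; rewrite -ltnNge; apply: ltn_sub2l => //; apply: ltn_trans lt_g.
- have := gmax (set_last g r); rewrite !ffunE ?eqxx /=.
  rewrite set_last_chain ?set_last_across_empty // => /(_ isT).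
  by apply/negP; rewrite -ltnNge; apply: ltn_sub2r => //; apply: ltn_trans lt_r.
Qed.

(** * Corner cells *)

(** Both [positions] and [values] frame a list by 0 and n + 1; the first and the
    last gaps of such a list are bounded by the frame on one side, which every
    letter satisfies. *)
Lemma nth_frame_first (s : seq nat) (n x : nat) : 0 < size s ->
  (nth 0 (0 :: rcons s n.+1) 0 < x.+1 < nth 0 (0 :: rcons s n.+1) 1)
    = (x.+1 < nth 0 s 0).
Proof. by case: s. Qed.

Lemma nth_frame_last (s : seq nat) (n x : nat) : 0 < size s -> x < n ->
  (nth 0 (0 :: rcons s n.+1) (size s) < x.+1
     < nth 0 (0 :: rcons s n.+1) (size s).+1)
    = (nth 0 s (size s).-1 < x.+1).
Proof.
case: s => // y s _ lt_xn.
by rewrite [nth _ _ _.+2]/= nth_rcons /= ltnn eqxx (ltnS x.+1) lt_xn andbT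
           -rcons_cons nth_rcons /= leqnn.
Qed.

Section Corners.

Variables (n m : nat) (sigma : 'S_n) (f : {ffun 'I_m.+2 -> 'I_n}).

Let letters (F : 'I_n -> nat) := [seq (F (f a)).+1 | a <- enum 'I_m.+2].

Let size_letters F : size (letters F) = m.+2.
Proof. by rewrite size_map size_enum_ord. Qed.

Let nth_letters F (a : 'I_m.+2) : nth 0 (letters F) a = (F (f a)).+1.
Proof. by rewrite (nth_map a) ?size_enum_ord // nth_ord_enum. Qed.

Lemma positions_first (r : 'I_n) :
  (nth 0 (positions f) 0 < r.+1 < nth 0 (positions f) 1) = (r < f ord0).
Proof.
rewrite nth_frame_first ?(size_letters val) //.
by rewrite (nth_letters val ord0).
Qed.

Lemma positions_last (r : 'I_n) :
  (nth 0 (positions f) m.+2 < r.+1 < nth 0 (positions f) m.+3)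
    = (f ord_max < r).
Proof.
have := @nth_frame_last (letters val) n r.
by rewrite (size_letters val) (nth_letters val ord_max) => ->.
Qed.

(** [lo] and [hi] are the positions of the smallest and the largest selected
    value: the two ends of the sequence, in an order that depends on its
    direction. *)
Lemma values_first_last (s : seq nat) (lo hi : 'I_n) (r : 'I_n) :
    values sigma f = 0 :: rcons s n.+1 -> size s = m.+2 ->
    nth 0 s 0 = (sigma lo).+1 -> nth 0 s m.+1 = (sigma hi).+1 ->
  ((nth 0 (values sigma f) 0 < (sigma r).+1 < nth 0 (values sigma f) 1)
     = (sigma r < sigma lo))
  * ((nth 0 (values sigma f) m.+2 < (sigma r).+1
        < nth 0 (values sigma f) m.+3) = (sigma hi < sigma r)).
Proof.
move=> -> ss slo shi; split.
  by rewrite nth_frame_first ?ss // slo.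
by have := @nth_frame_last s n (sigma r); rewrite ss shi => ->.
Qed.

Definition ascends : rel 'I_n := [rel x y | sigma x < sigma y].
Definition descends : rel 'I_n := [rel x y | sigma y < sigma x].

Let sorted_letters (F : 'I_n -> nat) (lt : rel nat) :
    (forall a b : 'I_m.+2, a < b -> lt (F (f a)).+1 (F (f b)).+1) ->
  sorted lt (letters F).
Proof.
move=> H; rewrite sorted_map.
apply: (@sub_sorted _ (relpre val ltn)) => [a b|]; first exact: H.
by rewrite -sorted_map val_enum_ord iota_ltn_sorted.
Qed.

Lemma values_ascending (r : 'I_n) : chain ascends f ->
  ((nth 0 (values sigma f) 0 < (sigma r).+1 < nth 0 (values sigma f) 1)
     = (sigma r < sigma (f ord0)))
  * ((nth 0 (values sigma f) m.+2 < (sigma r).+1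
        < nth 0 (values sigma f) m.+3) = (sigma (f ord_max) < sigma r)).
Proof.
move=> /chainP chf.
apply: (@values_first_last (letters (val \o sigma))).
- rewrite /values sorted_sort //; first exact: leq_trans.
  apply: (sorted_letters (F := val \o sigma)).
  by move=> a b /chf[_ /ltnW].
- exact: size_letters.
- exact: (nth_letters _ ord0).
- exact: (nth_letters _ ord_max).
Qed.

(** Sorting a decreasing list reverses it, so the extreme values exchange their
    places. *)
Lemma values_descending (r : 'I_n) : chain descends f ->
  ((nth 0 (values sigma f) 0 < (sigma r).+1 < nth 0 (values sigma f) 1)
     = (sigma r < sigma (f ord_max)))
  * ((nth 0 (values sigma f) m.+2 < (sigma r).+1
        < nth 0 (values sigma f) m.+3) = (sigma (f ord0) < sigma r)).
Proof.
move=> /chainP chf.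
apply: (@values_first_last (rev (letters (val \o sigma)))).
- rewrite /values; congr (_ :: rcons _ _).
  apply: (sorted_eq leq_trans anti_leq) (sort_sorted leq_total _) _ _.
    rewrite rev_sorted; apply: (sorted_letters (F := val \o sigma)).
    by move=> a b /chf[_ /ltnW].
  by rewrite perm_sort perm_sym perm_rev.
- by rewrite size_rev size_letters.
- by rewrite nth_rev size_letters // subSS subn0 (nth_letters _ ord_max).
- by rewrite nth_rev size_letters // subnn (nth_letters _ ord0).
Qed.

(** * Occurrences of monotone patterns *)

(** A chain decides every comparison of values: a pair of indices in the wrong
    order follows from the one in the right order by asymmetry, so order
    isomorphism to a monotone permutation carries nothing more. *)
Lemma occurrence_increasing (S : {set 'I_m.+3 * 'I_m.+3}) :
  occurrence sigma f (MeshPattern (increasing_perm m.+2) S) =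
  chain ascends f && [forall c in S, forall r : 'I_n, ~~ in_cell sigma f c r].
Proof.
rewrite /occurrence andbA; congr (_ && _).
apply/andP/chainP=> [[H1 H2] a b lt_ab|H].
  move/forallP/(_ a)/forallP/(_ b)/implyP/(_ lt_ab): H1 => ->.
  move/forallP/(_ a)/forallP/(_ b)/eqP: H2.
  by rewrite /ascends /= !perm1 lt_ab => ->.
split; apply/forallP=> a; apply/forallP=> b; first by apply/implyP=> /H[].
rewrite /= !perm1; apply/eqP.
case: (ltngtP a b) => [/H[_ //]|/H[_ /= lt_ba]|/val_inj->]; last exact: ltnn.
by apply/negbTE; rewrite -leqNgt ltnW.
Qed.

Lemma occurrence_decreasing (S : {set 'I_m.+3 * 'I_m.+3}) :
  occurrence sigma f (MeshPattern (decreasing_perm m.+2) S) =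
  chain descends f && [forall c in S, forall r : 'I_n, ~~ in_cell sigma f c r].
Proof.
have rev_lt (a b : 'I_m.+2) : (rev_ord a < rev_ord b) = (b < a).
  by rewrite /= ltn_sub2lE.
rewrite /occurrence andbA; congr (_ && _).
apply/andP/chainP=> [[H1 H2] a b lt_ab|H].
  move/forallP/(_ a)/forallP/(_ b)/implyP/(_ lt_ab): H1 => ->.
  move/forallP/(_ b)/forallP/(_ a)/eqP: H2.
  by rewrite /descends /= /decreasing_perm !permE rev_lt lt_ab => ->.
split; apply/forallP=> a; apply/forallP=> b; first by apply/implyP=> /H[].
rewrite /= /decreasing_perm !permE rev_lt; apply/eqP.
case: (ltngtP b a) => [/H[_ //]|/H[_ /= lt_ba]|/val_inj->]; last exact: ltnn.
by apply/negbTE; rewrite -leqNgt ltnW.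
Qed.

(** * Shaded corners *)

Lemma shading_setU (A B : {set 'I_m.+3 * 'I_m.+3}) :
  [forall c in A :|: B, forall r : 'I_n, ~~ in_cell sigma f c r] =
  [forall c in A, forall r : 'I_n, ~~ in_cell sigma f c r] &&
  [forall c in B, forall r : 'I_n, ~~ in_cell sigma f c r].
Proof.
apply/forall_inP/andP=> [H|[/forall_inP HA /forall_inP HB] c].
  by split; apply/forall_inP=> c Hc; apply: H; rewrite inE Hc ?orbT.
by case/setUP=> [/HA|/HB].
Qed.

Lemma shading_set2 (c1 c2 : 'I_m.+3 * 'I_m.+3) :
  [forall c in [set c1; c2], forall r : 'I_n, ~~ in_cell sigma f c r] =
  [forall r : 'I_n, ~~ in_cell sigma f c1 r && ~~ in_cell sigma f c2 r].
Proof.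
apply/forall_inP/forallP=> [H r|H c c12].
  by rewrite (forallP (H c1 (set21 _ _))) (forallP (H c2 (set22 _ _))).
apply/forallP=> r; have /andP[H1 H2] := H r.
by case/set2P: c12 => ->.
Qed.

(** The antidiagonal pair is the shading of [meshA] and the diagonal pair that
    of [meshD]; each is what the other pattern adds to obtain all corners. *)
Lemma corners_diagonals :
  corners m.+2 = [set (ord0, ord_max); (ord_max, ord0)]
             :|: [set (ord0, ord0); (ord_max, ord_max)].
Proof. by apply/setP=> c; rewrite !inE; do 4!case: (c == _). Qed.

Lemma ascending_antidiagonal : chain ascends f ->
  [forall c in [set (ord0, ord_max); (ord_max, ord0)],
     forall r : 'I_n, ~~ in_cell sigma f c r] = across_empty ascends f.
Proof.
move=> chf; rewrite shading_set2; apply: eq_forallb => r.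
by rewrite /in_cell positions_first positions_last !(values_ascending r chf).
Qed.

Lemma ascending_diagonal : chain ascends f ->
  [forall c in [set (ord0, ord0); (ord_max, ord_max)],
     forall r : 'I_n, ~~ in_cell sigma f c r] = along_empty ascends f.
Proof.
move=> chf; rewrite shading_set2; apply: eq_forallb => r.
by rewrite /in_cell positions_first positions_last !(values_ascending r chf).
Qed.

Lemma descending_diagonal : chain descends f ->
  [forall c in [set (ord0, ord0); (ord_max, ord_max)],
     forall r : 'I_n, ~~ in_cell sigma f c r] = across_empty descends f.
Proof.
move=> chf; rewrite shading_set2; apply: eq_forallb => r.
by rewrite /in_cell positions_first positions_last !(values_descending r chf).
Qed.

Lemma descending_antidiagonal : chain descends f ->
  [forall c in [set (ord0, ord_max); (ord_max, ord0)],
     forall r : 'I_n, ~~ in_cell sigma f c r] = along_empty descends f.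
Proof.
move=> chf; rewrite shading_set2; apply: eq_forallb => r.
by rewrite /in_cell positions_first positions_last !(values_descending r chf).
Qed.

Lemma occurrence_meshA :
  occurrence sigma f (meshA m.+2) = chain ascends f && across_empty ascends f.
Proof.
rewrite occurrence_increasing.
by case chf: (chain _ f); rewrite //= ascending_antidiagonal.
Qed.

Lemma occurrence_meshA_tilde :
  occurrence sigma f (meshA_tilde m.+2) =
  [&& chain ascends f, across_empty ascends f & along_empty ascends f].
Proof.
rewrite occurrence_increasing corners_diagonals shading_setU.
case chf: (chain _ f) => //=.
by rewrite ascending_antidiagonal // ascending_diagonal.
Qed.

Lemma occurrence_meshD :
  occurrence sigma f (meshD m.+2) = chain descends f && across_empty descends f.
Proof.
rewrite occurrence_decreasing.
by case chf: (chain _ f); rewrite //= descending_diagonal.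
Qed.

Lemma occurrence_meshD_tilde :
  occurrence sigma f (meshD_tilde m.+2) =
  [&& chain descends f, across_empty descends f & along_empty descends f].
Proof.
rewrite occurrence_decreasing corners_diagonals shading_setU.
case chf: (chain _ f) => //=.
by rewrite andbC descending_antidiagonal // descending_diagonal.
Qed.

End Corners.

(** * Avoidance *)

Lemma avoiders_unshaded n m (p q : mesh_pattern m.+2)
    (R : 'S_n -> rel 'I_n) :
    (forall sigma, transitive (R sigma)) ->
    (forall sigma (f : {ffun 'I_m.+2 -> 'I_n}), occurrence sigma f p =
       chain (R sigma) f && across_empty (R sigma) f) ->
    (forall sigma (f : {ffun 'I_m.+2 -> 'I_n}), occurrence sigma f q =
       [&& chain (R sigma) f, across_empty (R sigma) f
         & along_empty (R sigma) f]) ->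
  avoiders n p = avoiders n q.
Proof.
move=> trR occ_p occ_q; apply/setP=> sigma; rewrite !inE; congr negb.
apply/existsP/existsP=> -[f].
  rewrite occ_p => /andP[chf empf].
  have [g Hg] := widest_chain_unshaded (trR sigma) chf empf.
  by exists g; rewrite occ_q.
by rewrite occ_q => /and3P[chf empf _]; exists f; rewrite occ_p chf.
Qed.

Theorem proposition1p8 (n k : nat) (hk : 1 < k) (hkn : k <= n) :
  avoiders n (meshA k) = avoiders n (meshA_tilde k) /\
  avoiders n (meshD k) = avoiders n (meshD_tilde k).
Proof.
case: k hk {hkn} => [|[|m]] // _; split.
- apply: (avoiders_unshaded (R := @ascends n)).
  + by move=> sigma y x z; apply: ltn_trans.
  + exact: occurrence_meshA.
  + exact: occurrence_meshA_tilde.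
- apply: (avoiders_unshaded (R := @descends n)).
  + by move=> sigma y x z /= lt_yx lt_zy; apply: ltn_trans lt_yx.
  + exact: occurrence_meshD.
  + exact: occurrence_meshD_tilde.
Qed.
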